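(* Let $\alpha\in\mathcal P$ be such that $\rho:=\lim_{n\to\infty}t_{n+1}/t_n$ exists. (i) If $0\le\rho<1/2$, then $\mathcal M_\alpha$ is a Cantor set. (ii) If $1/2<\rho<1$, then $\mathcal M_\alpha$ is a finite union of closed intervals.
   Context: A partition $\alpha\in\mathcal P$ is given by a strictly decreasing sequence $(t_n)_{n\ge1}\subseteq(0,1]$ with $t_1=1$ and $t_n\to0$ (the intervals being $(t_{n+1},t_n]$ together with $\{0\}$). Put $a_n=t_n-t_{n+1}$. For $\varepsilon=(\varepsilon_n)\in\{0,1\}^{\mathbb N}$ and $z\in(0,1]$ let $F_\varepsilon(z)=\sum_{n:\,a_n/t_{n+1-\varepsilon_n}<z}a_n+\sum_{n:\,a_n/t_{n+1-\varepsilon_n}\ge z}t_{n+1-\varepsilon_n}z$, let $M_\varepsilon=\int_0^1(1-F_\varepsilon(z))\,dz$, and $\mathcal M_\alpha=\{M_\varepsilon:\varepsilon\in\{0,1\}^{\mathbb N}\}$. A Cantor set is a nonempty compact subset of $\mathbb R$ with no interior points and no isolated points. *)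

(* Defs.v *)
From mathcomp Require Import all_boot all_order all_algebra.
From mathcomp Require Import all_classical all_reals all_analysis.

Set Implicit Arguments.
Unset Strict Implicit.
Unset Printing Implicit Defensive.

Import Order.TTheory GRing.Theory Num.Theory.
Import numFieldNormedType.Exports.

Local Open Scope classical_set_scope.
Local Open Scope ring_scope.

(* Sequences are indexed from 0: [t n] is the endpoint written t_{n+1}, and
   [gap t n], [eps n] are a_{n+1}, epsilon_{n+1}.  The partition itself is
   {0} together with the intervals ]t n.+1, t n]. *)
Definition is_partition (R : realType) (t : nat -> R) : Prop :=
  [/\ t 0%N = 1,
      forall n, 0 < t n <= 1,
      forall n, t n.+1 < t n
    & t @ \oo --> 0].

Definition gap (R : realType) (t : nat -> R) (n : nat) : R := t n - t n.+1.

(* [eps n] is coerced to 0 or 1, so this is [t n] or [t n.+1]. *)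
Definition endpoint (R : realType) (t : nat -> R) (eps : nat -> bool)
  (n : nat) : R := t (n.+1 - eps n)%N.

(* The two series are sums of nonnegative terms bounded by [gap t n], whose
   sum is 1; hence both limits exist for 0 <= z. *)
Definition Feps (R : realType) (t : nat -> R) (eps : nat -> bool) (z : R) : R :=
  \big[+%R/0]_(0 <= n <oo | gap t n / endpoint t eps n < z) gap t n +
  \big[+%R/0]_(0 <= n <oo | gap t n / endpoint t eps n >= z)
     (endpoint t eps n * z).

Definition Meps (R : realType) (t : nat -> R) (eps : nat -> bool) : R :=
  \int[lebesgue_measure]_(z in `[0, 1]) (1 - Feps t eps z).

Definition Mset (R : realType) (t : nat -> R) : set R :=
  [set Meps t eps | eps in [set: nat -> bool]].

(* The library's [cantor_like] asks for a zero-dimensional space; on the real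
   line the definition used here asks for empty interior. *)
Definition is_cantor_set (R : realType) (A : set R) : Prop :=
  [/\ A !=set0, compact A, interior A = set0 & isolated A = set0].

Definition is_finite_union_of_closed_intervals (R : realType) (A : set R) :
  Prop :=
  exists s : seq (R * R),
    (forall p, p \in s -> p.1 < p.2) /\
    A = \bigcup_(p in [set` s]) `[p.1, p.2]%classic.

(* Main.v *)
(* Integrating termwise, M_eps = sum_n I(a_n, e_n), where
   I(a, e) = int_0^1 max(0, a - e z) dz and e_n is the chosen endpoint.  Passing
   from the right to the left endpoint raises the n-th term by some c_n > 0, so
   the set of values is a translate of the set of subsums of the series of the
   c_n.  Since c_n is t_n times a positive function of t_{n+1} / t_n which is
   continuous away from 1/2, the ratio c_{n+1} / c_n also tends to rho, and
   Kakeya's analysis of subsums applies.  With R_n the n-th tail, the set of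
   subsums is covered by 2^n intervals of length R_n.  If rho < 1/2 then
   2^n R_n -> 0, so the interior is empty, while compactness comes from the
   Cantor space {0,1}^N and flipping a far digit shows that no point is isolated.
   If rho > 1/2 then c_n <= R_{n+1} eventually, and the greedy algorithm shows
   that the subsums of a far tail fill an interval. *)
Require Import Defs.
From mathcomp Require Import all_boot all_order all_algebra.
From mathcomp Require Import all_classical all_reals all_analysis.
From mathcomp Require Import measurable_realfun ring lra.
Import Order.TTheory GRing.Theory Num.Theory.
Import numFieldNormedType.Exports.
Local Open Scope classical_set_scope.
Local Open Scope ring_scope.

(** * Subsums of a positive series *)

(** Term [n] is included. Writing the tail as a limit minus a partial sum makes its recursion and
    its convergence to 0 plain algebra of limits. *)
Definition tail {R : realType} (c : nat -> R) (n : nat) : R :=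
  limn (series c) - series c n.

Definition subsum {R : realType} (c : nat -> R) (eps : nat -> bool) : R :=
  limn (series (fun k => c k *+ eps k)).

(** A list with repetitions, so that its size is exactly [2 ^ n] even when different choices give
    equal sums. *)
Fixpoint prefix_sums {R : realType} (c : nat -> R) (n : nat) : seq R :=
  if n is m.+1
  then prefix_sums c m ++ [seq x + c m | x <- prefix_sums c m]
  else [:: 0].

Lemma tailS {R : realType} (c : nat -> R) (n : nat) :
  tail c n = c n + tail c n.+1.
Proof. by rewrite /tail seriesSr; ring. Qed.

Lemma cvg_tail {R : realType} (c : nat -> R) :
  cvgn (series c) -> tail c @ \oo --> 0.
Proof.
move=> cc; rewrite -[X in _ --> X](subrr (limn (series c))).
by apply: cvgB => //; exact: cvg_cst.
Qed.

Lemma tail_lt {R : realType} (c : nat -> R) (r : R) :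
  cvgn (series c) -> 0 < r -> exists n, tail c n < r.
Proof.
move=> cc r0; have /cvgrPdist_lt/(_ r r0)[n _ nr] := cvg_tail c cc.
exists n; have := nr n (leqnn n); rewrite sub0r normrN.
by apply: le_lt_trans; exact: ler_norm.
Qed.

Lemma tail_ge0 {R : realType} (c : nat -> R) (n : nat) :
  (forall k, 0 <= c k) -> cvgn (series c) -> 0 <= tail c n.
Proof.
move=> c0 cc; rewrite subr_ge0; apply: nondecreasing_cvgn_le => //.
by apply: nondecreasing_series.
Qed.

Lemma tail_gt0 {R : realType} (c : nat -> R) (n : nat) :
  (forall k, 0 < c k) -> cvgn (series c) -> 0 < tail c n.
Proof.
move=> c0 cc; rewrite tailS ltr_pwDl// tail_ge0// => k.
exact: ltW.
Qed.

Lemma tail_le {R : realType} (u v : nat -> R) (n : nat) :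
  cvgn (series u) -> cvgn (series v) ->
  (forall k, (n <= k)%N -> u k <= v k) -> tail u n <= tail v n.
Proof.
move=> cu cv uv.
apply: (@ler_cvg_to _ \oo _ _ (fun m => series u m - series u n)
  (fun m => series v m - series v n)).
- by apply: cvgB => //; exact: cvg_cst.
- by apply: cvgB => //; exact: cvg_cst.
near=> m.
have nm : (n <= m)%N by near: m; exists n.
rewrite !sub_series_geq// big_nat [leRHS]big_nat.
by apply: ler_sum => k /andP[nk _]; exact: uv.
Unshelve. all: by end_near. Qed.

Lemma tail_shift {R : realType} (c : nat -> R) (n : nat) :
  cvgn (series c) ->
  cvgn (series (fun k => c k.+1)) /\ tail (fun k => c k.+1) n = tail c n.+1.
Proof.
move=> cc.
have shift m : series (fun k => c k.+1) m = series c m.+1 - c 0%N.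
  elim: m => [|m IH]; first by rewrite seriesSr /series /= !big_geq//; ring.
  by rewrite seriesSr IH [series c m.+2]seriesSr; ring.
have cv : series (fun k => c k.+1) @ \oo --> limn (series c) - c 0%N.
  rewrite (funext shift); apply: cvgB; last exact: cvg_cst.
  by rewrite (cvg_shiftS (series c)).
split; first exact: cvgP cv.
by rewrite /tail (cvg_lim _ cv)// shift; ring.
Qed.

Lemma tail_scale {R : realType} (c : nat -> R) (q : R) (n : nat) :
  cvgn (series c) ->
  cvgn (series (fun k => q * c k)) /\ tail (fun k => q * c k) n = q * tail c n.
Proof.
move=> cc.
have scale m : series (fun k => q * c k) m = q * series c m.
  by rewrite /series /= mulr_sumr.
have cv : series (fun k => q * c k) @ \oo --> q * limn (series c).
  by rewrite (funext scale); apply: cvgMr.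
split; first exact: cvgP cv.
by rewrite /tail (cvg_lim _ cv)// scale; ring.
Qed.

(** The tail at [n.+1] is the tail at [n] of the shifted series, so a termwise ratio bound passes to
    tails by comparison with the scaled series. *)
Lemma tail_ratio_le {R : realType} (c : nat -> R) (q : R) (n : nat) :
  cvgn (series c) -> (forall k, (n <= k)%N -> c k.+1 <= q * c k) ->
  tail c n.+1 <= q * tail c n.
Proof.
move=> cc cq; have [cu <-] := tail_shift c n cc; have [cv <-] := tail_scale c q n cc.
exact: tail_le.
Qed.

Lemma tail_ratio_ge {R : realType} (c : nat -> R) (q : R) (n : nat) :
  cvgn (series c) -> (forall k, (n <= k)%N -> q * c k <= c k.+1) ->
  q * tail c n <= tail c n.+1.
Proof.
move=> cc cq; have [cu <-] := tail_shift c n cc; have [cv <-] := tail_scale c q n cc.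
exact: tail_le.
Qed.

Lemma cvg_subsum {R : realType} (c : nat -> R) (eps : nat -> bool) :
  (forall k, 0 <= c k) -> cvgn (series c) ->
  cvgn (series (fun k => c k *+ eps k)).
Proof.
move=> c0; apply: series_le_cvg => // n; first exact: mulrn_wge0.
by case: (eps n); rewrite ?mulr1n ?mulr0n.
Qed.

Lemma subsum_ge {R : realType} (c : nat -> R) (eps : nat -> bool) (n : nat) :
  (forall k, 0 <= c k) -> cvgn (series c) ->
  series (fun k => c k *+ eps k) n <= subsum c eps.
Proof.
move=> c0 cc; rewrite -subr_ge0; apply: tail_ge0; last exact: cvg_subsum.
by move=> k; exact: mulrn_wge0.
Qed.

Lemma subsumC {R : realType} (c : nat -> R) (eps : nat -> bool) :
  (forall k, 0 <= c k) -> cvgn (series c) ->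
  subsum c eps + subsum c (fun k => ~~ eps k) = limn (series c).
Proof.
move=> c0 cc; have cs e := cvg_subsum c e c0 cc.
rewrite /subsum -(lim_seriesD (cs eps) (cs (fun k => ~~ eps k))).
congr (limn (series _)); apply/funext => k /=; rewrite fctE.
by case: (eps k); rewrite /= ?mulr1n ?mulr0n ?addr0 ?add0r.
Qed.

(** By [subsumC] this is the lower bound [subsum_ge] for the complementary choice. *)
Lemma subsum_le {R : realType} (c : nat -> R) (eps : nat -> bool) (n : nat) :
  (forall k, 0 <= c k) -> cvgn (series c) ->
  subsum c eps <= series (fun k => c k *+ eps k) n + tail c n.
Proof.
move=> c0 cc; have := subsum_ge c (fun k => ~~ eps k) n c0 cc.
have := subsumC c eps c0 cc; rewrite /tail.
have -> : series c n = series (fun k => c k *+ eps k) n +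
    series (fun k => c k *+ ~~ eps k) n.
  rewrite /series /= -big_split; apply: eq_bigr => k _ /=.
  by case: (eps k); rewrite /= ?mulr1n ?mulr0n ?addr0 ?add0r.
lra.
Qed.

Lemma subsum_dist {R : realType} (c : nat -> R) (e d : nat -> bool) (n : nat) :
  (forall k, 0 <= c k) -> cvgn (series c) ->
  (forall k, (k < n)%N -> e k = d k) -> `|subsum c e - subsum c d| <= tail c n.
Proof.
move=> c0 cc ed.
have eqs : series (fun k => c k *+ e k) n = series (fun k => c k *+ d k) n.
  by apply: eq_big_nat => k /andP[_ kn]; rewrite ed.
have := subsum_le c e n c0 cc; have := subsum_ge c e n c0 cc.
have := subsum_le c d n c0 cc; have := subsum_ge c d n c0 cc.
rewrite eqs ler_norml; lra.
Qed.

(** * Finite subsums and the length of covered intervals *)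

Lemma size_prefix_sums {R : realType} (c : nat -> R) (n : nat) :
  size (prefix_sums c n) = (2 ^ n)%N.
Proof.
by elim: n => //= n IH; rewrite size_cat size_map IH expnS mul2n addnn.
Qed.

Lemma mem_prefix_sums {R : realType} (c : nat -> R) (n : nat) (x : R) :
  (x \in prefix_sums c n) <->
  exists eps : nat -> bool, x = series (fun k => c k *+ eps k) n.
Proof.
split.
  elim: n x => [|n IH] x /=.
    by rewrite inE => /eqP ->; exists xpred0; rewrite /series /= big_geq.
  rewrite mem_cat => /orP[/IH[eps ->]|/mapP[y /IH[eps ->] ->]].
    (* The choice from the induction is arbitrary at index [n]; it is reset there to 0, and below to
       1. *)
    exists (fun k => (k != n) && eps k).
    rewrite seriesSr eqxx mulr0n addr0; apply: eq_big_nat => k /andP[_ kn].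
    by rewrite ltn_eqF.
  exists (fun k => (k == n) || eps k).
  rewrite seriesSr eqxx mulr1n; congr (_ + _).
  by apply: eq_big_nat => k /andP[_ kn]; rewrite ltn_eqF.
move=> [eps ->]; elim: n => [|n IH] /=; first by rewrite /series /= big_geq ?inE.
rewrite seriesSr mem_cat; case: (eps n) => /=.
  by rewrite mulr1n; apply/orP; right; exact: map_f.
by rewrite mulr0n addr0 IH.
Qed.

(** Finite subadditivity of Lebesgue measure. *)
Lemma interval_cover_le {R : realType} (a b L : R) (s : seq R) :
  0 <= L -> a <= b ->
  `[a, b]%classic `<=` \bigcup_(x in [set` s]) `[x, x + L]%classic ->
  b - a <= (size s)%:R * L.
Proof.
move=> L0 ab cover.
(* The case [x = y] is included, since [L = 0] and [a = b] are allowed. *)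
have itvE (x y : R) : x <= y ->
    lebesgue_measure (`[x, y]%classic : set R) = (y - x)%:E.
  move=> xy; rewrite lebesgue_measure_itv /= lte_fin.
  by case: ltgtP xy => // -> _; rewrite subrr.
have cover' : `[a, b]%classic `<=` \big[setU/set0]_(i < size s)
    `[nth 0 s i, nth 0 s i + L]%classic.
  move=> y /cover[x /= xs xy].
  rewrite -(bigcup_mkord _ (fun i => `[nth 0 s i, nth 0 s i + L]%classic)).
  by exists (index x s); rewrite /= ?index_mem ?nth_index.
rewrite -lee_fin -(itvE _ _ ab).
apply: le_trans (@content_subadditive _ _ _ (@lebesgue_measure R) _
  (fun i => `[nth 0 s i, nth 0 s i + L]%classic) (size s) _ _ cover') _ => //.
rewrite mulr_natl -[X in L *+ X](card_ord (size s)) -sumr_const -sumEFin.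
apply: lee_sum => i _; rewrite le_eqVlt; apply/orP; left; apply/eqP.
by transitivity ((nth 0 s i + L - nth 0 s i)%:E);
  [apply: itvE; rewrite lerDl|congr (_%:E); ring].
Qed.

(** * Topology of the set of subsums *)

Lemma continuous_subsum {R : realType} (c : nat -> R) :
  (forall k, 0 <= c k) -> cvgn (series c) ->
  continuous (subsum c : cantor_space -> R).
Proof.
move=> c0 cc e; apply/cvgrPdist_lt => r r0.
have [n nr] := tail_lt c r cc r0.
(* In the product topology, fixing finitely many digits is a neighbourhood of [e], because [bool] is
   discrete; [subsum_dist] then bounds the change of the sum. *)
have agree : nbhs e [set d : nat -> bool | forall i : 'I_n, d i = e i].
  apply: (@filter_forall _ _ (fun (i : 'I_n) (d : nat -> bool) => d i = e i)
    (nbhs e)) => i.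
  exact: (@proj_continuous _ (fun _ : nat => (bool : topologicalType)) i e
    [set e i] (discrete_set1 (e i))).
apply: filterS agree => d dk; apply: le_lt_trans nr.
by apply: subsum_dist => // k kn; rewrite (dk (Ordinal kn)).
Qed.

Lemma compact_subsums {R : realType} (c : nat -> R) (B : R) :
  (forall k, 0 <= c k) -> cvgn (series c) ->
  compact [set B + subsum c eps | eps in [set: nat -> bool]].
Proof.
move=> c0 cc.
apply: (@continuous_compact cantor_space R (fun e => B + subsum c e) setT).
  apply: continuous_subspaceT => e; apply: cvgD; first exact: cvg_cst.
  exact: continuous_subsum.
exact: cantor_space_compact.
Qed.

Lemma subsums_not_isolated {R : realType} (c : nat -> R) (B : R) :
  (forall k, 0 < c k) -> cvgn (series c) ->
  isolated [set B + subsum c eps | eps in [set: nat -> bool]] = set0.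
Proof.
move=> c0 cc; have c0' k := ltW (c0 k).
apply/seteqP; split => // x [/set_mem[e _ <-]] [V + VE].
move=> /nbhs_ballP[r /= r0 rV].
have [n nr] := tail_lt c r cc r0.
(* Only digit [n] is flipped. The new point is within [tail c n < r] of the old one, so isolation
   would make them equal, although they differ by [c n] up to sign. *)
pose d k := if k == n then ~~ e n else e k.
have ed k : (k < n)%N -> e k = d k by move=> kn; rewrite /d ltn_eqF.
have de : B + subsum c d = B + subsum c e.
  have : (V `&` [set B + subsum c eps | eps in [set: nat -> bool]])
      (B + subsum c d).
    split; last by exists d.
    apply: rV; rewrite /ball /= opprD addrACA subrr add0r.
    by apply: le_lt_trans nr; exact: subsum_dist.
  by rewrite VE.
have lim_eq : (fun m => series (fun k => c k *+ d k) m -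
     series (fun k => c k *+ e k) m) @ \oo --> subsum c d - subsum c e.
  by apply: cvgB; exact: cvg_subsum.
have diff m : (n < m)%N -> series (fun k => c k *+ d k) m -
     series (fun k => c k *+ e k) m = c n *+ ~~ e n - c n *+ e n.
  elim: m => // m IH; rewrite ltnS leq_eqVlt => /predU1P[<-|nm].
    rewrite 2!seriesSr /d eqxx.
    rewrite (_ : series _ n = series (fun k => c k *+ e k) n); first ring.
    by apply: eq_big_nat => k /andP[_ kn]; rewrite ltn_eqF.
  by rewrite 2!seriesSr opprD addrACA IH// /d gtn_eqF// subrr addr0.
have : subsum c d - subsum c e = c n *+ ~~ e n - c n *+ e n.
  apply: (cvg_unique _ lim_eq) => //.
  apply: cvg_near_cst; exists n.+1 => // m /= nm; exact: diff.
move/addrI: de => ->; move: (c0 n) => cn; rewrite subrr => /eqP.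
by case: (e n); rewrite /= ?mulr1n ?mulr0n ?subr0 ?sub0r ?(eq_sym 0) ?oppr_eq0 gt_eqF.
Qed.

Lemma subsums_cover {R : realType} (c : nat -> R) (B : R) (n : nat) :
  (forall k, 0 <= c k) -> cvgn (series c) ->
  [set B + subsum c eps | eps in [set: nat -> bool]] `<=`
  \bigcup_(x in [set` [seq B + y | y <- prefix_sums c n]])
    `[x, x + tail c n]%classic.
Proof.
move=> c0 cc _ [e _ <-]; exists (B + series (fun k => c k *+ e k) n) => /=.
  by apply: map_f; apply/mem_prefix_sums; exists e.
rewrite in_itv /= lerD2l -addrA lerD2l.
by rewrite subsum_ge ?subsum_le.
Qed.

Lemma interior_subsums {R : realType} (c : nat -> R) (B q : R) (N : nat) :
  (forall k, 0 <= c k) -> cvgn (series c) -> 0 <= q < 1 / 2 ->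
  (forall k, (N <= k)%N -> c k.+1 <= q * c k) ->
  interior [set B + subsum c eps | eps in [set: nat -> bool]] = set0.
Proof.
move=> c0 cc /andP[q0 q2] cq; apply/seteqP; split => // x.
move=> /nbhs_ballP[r /= r0 rA].
(* The tails decay geometrically from [N] on. *)
have tailN k : tail c (N + k) <= q ^+ k * tail c N.
  elim: k => [|k IH]; first by rewrite addn0 expr0 mul1r.
  rewrite addnS exprS -mulrA; apply: (le_trans (y := q * tail c (N + k))).
    apply: tail_ratio_le => // j Nj; apply: cq.
    exact: leq_trans (leq_addr _ _) Nj.
  exact: ler_wpM2l.
(* The closed interval of radius [r / 2] about [x] has length [r] and lies in the open ball, hence
   in the union of the [2 ^ n] covering intervals. *)
have le_r n : r <= (2 ^ n)%:R * tail c n.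
  have -> : r = (x + r / 2) - (x - r / 2) by field.
  rewrite -(size_prefix_sums c n) -(size_map (+%R B)).
  apply: interval_cover_le; [exact: tail_ge0|lra|].
  apply: subset_trans (subsums_cover c B n c0 cc).
  apply: subset_trans rA => y; rewrite /ball /= in_itv /= ltr_norml => ?.
  lra.
(* For [n = N + k] the bound on [r] is at most this sequence, which vanishes in the limit because
   [2 * q < 1]. *)
have lim0 : (fun k => (2 ^ N)%:R * tail c N * (2 * q) ^+ k) @ \oo --> 0.
  rewrite -[X in _ --> X](mulr0 ((2 ^ N)%:R * tail c N)); apply: cvgMr.
  by apply: cvg_expr; rewrite ger0_norm; lra.
have : r <= 0.
  apply: (@ler_cvg_to _ \oo _ _ (fun=> r) _ _ _ (cvg_cst r) lim0).
  apply: nearW => k; apply: le_trans (le_r (N + k)%N) _.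
  rewrite expnD natrM exprMn -natrX.
  rewrite [leRHS](_ : _ = (2 ^ N)%:R * (2 ^ k)%:R * (q ^+ k * tail c N)).
    by rewrite ler_wpM2l ?mulr_ge0.
  by ring.
by rewrite leNgt r0.
Qed.

(* Greedy expansion: as long as every term is at most the tail after it, the
   remainder [rem k] stays between 0 and the corresponding tail. *)
Lemma subsum_greedy {R : realType} (c : nat -> R) (N : nat) (e : nat -> bool)
  (y : R) :
  (forall k, 0 <= c k) -> cvgn (series c) ->
  (forall k, (N <= k)%N -> c k <= tail c k.+1) ->
  0 <= y <= tail c N ->
  exists d : nat -> bool, subsum c d = series (fun k => c k *+ e k) N + y.
Proof.
move=> c0 cc ct y0.
pose rem := fix rem k : R :=
  if k is j.+1 then rem j - c (N + j)%N *+ (c (N + j)%N <= rem j)%R else y.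
pose d k := if (k < N)%N then e k else c k <= rem (k - N)%N.
have rem_bound k : 0 <= rem k <= tail c (N + k).
  elim: k => [|k]; first by rewrite addn0.
  rewrite [tail c (N + k)]tailS addnS /= => /andP[r0 r1].
  case: (leP (c (N + k)%N) (rem k)) => /= cr; rewrite ?mulr1n ?mulr0n; first by lra.
  (* A rejected term exceeds the remainder and is itself at most the next tail, so the remainder
     stays below that tail. *)
  by have := ct (N + k)%N (leq_addr _ _); lra.
have rem0 : rem @ \oo --> 0.
  apply: (@squeeze_cvgr _ _ _ _ (fun=> 0) (fun k => tail c (N + k))).
  - exact: nearW.
  - exact: cvg_cst.
  - have := cvg_tail c cc; rewrite -(cvg_shiftn N).
    by under eq_fun do rewrite addnC.
have psum k : series (fun k => c k *+ d k) (N + k)%N =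
    series (fun k => c k *+ e k) N + y - rem k.
  elim: k => [|k IH].
    rewrite addn0 /= addrK; apply: eq_big_nat => k /andP[_ kN].
    by rewrite /d kN.
  rewrite addnS seriesSr IH /= /d ltnNge leq_addr /= addKn; ring.
exists d; apply/cvg_lim => //.
rewrite -(cvg_shiftn N) (_ : (fun _ => _) = (fun k =>
  series (fun k => c k *+ e k) N + y - rem k)); last first.
  by apply/funext => k; rewrite addnC psum.
have := @cvgB _ _ _ \oo _ _ _ _ _
  (cvg_cst (series (fun k => c k *+ e k) N + y)) rem0.
by rewrite subr0; exact.
Qed.

(** The greedy expansion fills each interval of the cover of generation [N], so that the cover is an
    equality. *)
Lemma subsums_union {R : realType} (c : nat -> R) (B : R) (N : nat) :
  (forall k, 0 < c k) -> cvgn (series c) ->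
  (forall k, (N <= k)%N -> c k <= tail c k.+1) ->
  is_finite_union_of_closed_intervals
    [set B + subsum c eps | eps in [set: nat -> bool]].
Proof.
move=> c0 cc ct; have c0' k := ltW (c0 k).
exists [seq (B + y, B + y + tail c N) | y <- prefix_sums c N]; split.
  by move=> _ /mapP[y _ ->] /=; rewrite ltrDl; exact: tail_gt0.
apply/seteqP; split => x.
  move=> /(subsums_cover c B N c0' cc)[_ /= /mapP[y yP ->] xy].
  by exists (B + y, B + y + tail c N) => //=; apply/mapP; exists y.
move=> [_ /= /mapP[y /mem_prefix_sums[e ->] ->]] /=; rewrite in_itv /= => xy.
have [] := subsum_greedy c N e (x - B - series (fun k => c k *+ e k) N) c0' cc ct.
  by lra.
by move=> d dE; exists d => //; rewrite dE; ring.
Qed.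

(** * Termwise integration *)

Lemma integral_poly {R : realType} (p : {poly R}) (a b : R) : a < b ->
  (\int[lebesgue_measure]_(x in `[a, b]) (p^`()%R.[x])%:E =
   (p.[b] - p.[a])%:E)%E.
Proof.
move=> ab; rewrite (continuous_FTC2 (F := horner p))//.
- exact/continuous_subspaceT/continuous_horner.
- split.
  + by move=> x _; exact: derivable_horner.
  + by apply: cvg_at_right_filter; exact: continuous_horner.
  + by apply: cvg_at_left_filter; exact: continuous_horner.
- by move=> x _; rewrite derivE.
Qed.

Definition hinge {R : realType} (a e z : R) : R := Num.max 0 (a - e * z).

(** The integral of [hinge a e] over the unit interval, for positive [a] and [e]: [b] is the point
    where the hinge reaches 0, cut off at 1. *)
Definition hinge_int {R : realType} (a e : R) : R :=
  let b := Num.min 1 (a / e) in a * b - e * b ^+ 2 / 2.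

Lemma measurable_hinge {R : realType} (D : set R) (a e : R) :
  measurable_fun D (hinge a e).
Proof.
apply: (@measurable_maxr _ _ _ _ (fun=> 0) (fun z => a - e * z)) => //.
by apply: measurable_funB => //; apply: measurable_funM.
Qed.

Lemma integral_hinge {R : realType} (a e : R) : 0 < a -> 0 < e ->
  (\int[lebesgue_measure]_(z in `[0%R, 1%R]) (hinge a e z)%:E =
   (hinge_int a e)%:E)%E.
Proof.
move=> a0 e0; set b := Num.min 1 (a / e).
have b0 : 0 < b by rewrite lt_min ltr01 divr_gt0.
have b1 : b <= 1 by rewrite ge_min lexx.
have be (z : R) : z <= 1 -> (z <= b) = (e * z <= a).
  by move=> z1; rewrite le_min z1 /= ler_pdivlMr// mulrC.
transitivity (\int[lebesgue_measure]_(z in `[0%R, b]) (hinge a e z)%:E)%E.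
  have -> : `[0, b]%classic = `[0, 1]%classic `&` `[0, b]%classic :> set R.
    apply/seteqP; split => z /=; rewrite !in_itv /=; last by case.
    by move=> /andP[-> zb]; rewrite zb (le_trans zb b1).
  rewrite integral_mkcondr; apply: eq_integral => z.
  rewrite inE /= in_itv /= => /andP[z0 z1]; rewrite patchE.
  case: ifPn => // /negP; rewrite inE /= in_itv /= z0 /= be// => /negP.
  rewrite -ltNge => ez; rewrite /hinge max_l//; lra.
pose p : {poly R} := a *: 'X - (e / 2) *: 'X^2.
transitivity (\int[lebesgue_measure]_(z in `[0%R, b]) (p^`()%R.[z])%:E)%E.
  apply: eq_integral => z; rewrite inE /= in_itv /= => /andP[z0 zb].
  have := zb; rewrite be ?(le_trans zb)// => ez.
  rewrite /hinge max_r ?subr_ge0// /p derivB !derivZ derivX derivXn !hornerE; congr (_%:E).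
  by field.
rewrite integral_poly// /p !hornerE /hinge_int -/b; congr (_%:E).
by rewrite /=; field.
Qed.

(** Follows from [b <= 1] and [e * b <= a]. The upper bound lets the series of integrals be compared
    with the series of gaps. *)
Lemma hinge_int_bounds {R : realType} (a e : R) : 0 < a -> 0 < e ->
  0 <= hinge_int a e <= a.
Proof.
move=> a0 e0; rewrite /hinge_int; set b := Num.min 1 (a / e).
have b0 : 0 < b by rewrite lt_min ltr01 divr_gt0.
have b1 : b <= 1 by rewrite ge_min lexx.
have eb : e * b <= a by rewrite mulrC -ler_pdivlMr// ge_min lexx orbT.
nra.
Qed.

Lemma nneseries_EFin {R : realType} (u : nat -> R) : cvgn (series u) ->
  (\sum_(0 <= n <oo) (u n)%:E)%E = (limn (series u))%:E.
Proof.
move=> cu; rewrite -EFin_lim//; congr (limn _); apply/funext => n /=.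
by rewrite /series /= sumEFin.
Qed.

Lemma gap_gt0 {R : realType} (t : nat -> R) (n : nat) :
  is_partition t -> 0 < gap t n.
Proof. by case=> _ _ t_decr _; rewrite subr_gt0. Qed.

Lemma endpoint_gt0 {R : realType} (t : nat -> R) (eps : nat -> bool) (n : nat) :
  is_partition t -> 0 < endpoint t eps n.
Proof. by case=> _ t01 _ _; rewrite /endpoint; case/andP: (t01 (n.+1 - eps n)%N). Qed.

Lemma cvg_series_gap {R : realType} (t : nat -> R) :
  is_partition t -> series (gap t) @ \oo --> (1 : R).
Proof.
case=> t0 _ _ tcvg; rewrite (_ : series (gap t) = fun n => 1 - t n).
  rewrite -[X in _ --> X](subr0 (1 : R)); apply: cvgB => //; exact: cvg_cst.
apply/funext; elim=> [|n IH]; first by rewrite /series /= big_geq// t0 subrr.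
by rewrite seriesSr IH /gap; ring.
Qed.

(** The gaps sum to 1, so [1 - Feps t eps z] is the sum of each gap minus its term in [Feps], and
    that difference is a hinge. *)
Lemma FepsE {R : realType} (t : nat -> R) (eps : nat -> bool) (z : R) :
  is_partition t -> 0 <= z ->
  series (fun k => hinge (gap t k) (endpoint t eps k) z) @ \oo -->
  1 - Feps t eps z.
Proof.
move=> ht z0; set a := gap t; set e := endpoint t eps.
have a0 k : 0 < a k := gap_gt0 t k ht.
have e0 k : 0 < e k := endpoint_gt0 t eps k ht.
have ca := cvg_series_gap t ht.
(* The filtered sums become full series with 0 at the excluded indices; both are dominated by the
   gaps. *)
pose u k := if a k / e k < z then a k else 0.
pose v k := if z <= a k / e k then e k * z else 0.
have cu : cvgn (series u).
  apply: (series_le_cvg _ _ _ (cvgP _ ca)) => k; rewrite /u.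
  - by case: ifP => // _; exact: ltW.
  - exact: ltW.
  - by case: ifP => // _; exact: ltW.
have cv : cvgn (series v).
  apply: (series_le_cvg _ _ _ (cvgP _ ca)) => k; rewrite /v.
  - by case: ifP => // _; exact: mulr_ge0 (ltW (e0 k)) z0.
  - exact: ltW.
  - by case: ifP; rewrite ?ler_pdivlMr ?(mulrC z)// => _; exact: ltW.
have -> : Feps t eps z = limn (series u) + limn (series v).
  rewrite /Feps; congr (limn _ + limn _); apply/funext => n /=.
    by rewrite big_mkcond.
  by rewrite big_mkcond.
rewrite (_ : series _ = (fun n => series a n - (series u n + series v n))).
  by apply: cvgB => //; apply: cvgD.
apply/funext => n; rewrite /series /= -big_split -sumrB.
apply: eq_bigr => k _; rewrite /hinge /u /v /=.
case: (leP z (a k / e k)); rewrite ?ler_pdivlMr ?ltr_pdivrMr// => zk.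
  by rewrite max_r ?add0r// subr_ge0 mulrC.
by rewrite max_l ?addr0 ?subrr// subr_le0 mulrC ltW.
Qed.

Lemma cvg_series_hinge_int {R : realType} (t : nat -> R) (eps : nat -> bool) :
  is_partition t ->
  cvgn (series (fun k => hinge_int (gap t k) (endpoint t eps k))).
Proof.
move=> ht; apply: (series_le_cvg _ _ _ (cvgP _ (cvg_series_gap t ht))) => k;
  have := hinge_int_bounds _ _ (gap_gt0 t k ht) (endpoint_gt0 t eps k ht);
  by [case/andP | move=> _; exact/ltW/gap_gt0].
Qed.

Lemma MepsE {R : realType} (t : nat -> R) (eps : nat -> bool) :
  is_partition t ->
  Meps t eps = limn (series (fun k => hinge_int (gap t k) (endpoint t eps k))).
Proof.
move=> ht; rewrite /Meps /Rintegral.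
transitivity (fine (\int[lebesgue_measure]_(z in `[0%R, 1%R])
    \sum_(0 <= k <oo) (hinge (gap t k) (endpoint t eps k) z)%:E)%E).
  congr fine; apply: eq_integral => z; rewrite inE /= in_itv /= => /andP[z0 _].
  have cz := FepsE t eps z ht z0.
  by rewrite nneseries_EFin ?(cvg_lim _ cz)//; exact: cvgP cz.
(* The terms are nonnegative and measurable, so sum and integral may be exchanged in the extended
   reals. *)
rewrite integral_nneseries//; last 2 first.
- by move=> k; apply/measurable_EFinP; exact: measurable_hinge.
- by move=> k z _; rewrite lee_fin le_max lexx.
under eq_eseriesr do rewrite integral_hinge ?gap_gt0 ?endpoint_gt0//.
by rewrite nneseries_EFin//; exact: cvg_series_hinge_int.
Qed.

(** * Asymptotics of the jumps *)

(* The jump of an interval ]r, 1]; for ]t n.+1, t n] it scales by [t n].  The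
   two formulas correspond to the two values of the minimum in [hinge_int]. *)
Definition unit_jump {R : realType} (r : R) : R :=
  if r < 1 / 2 then (1 - r - r ^+ 2) / 2 else (1 - r) ^+ 3 / (2 * r).

(** The hinge of slope [s] vanishes at [1 - r], inside the unit interval; that of slope [r * s]
    vanishes at [(1 - r) / r], which is at least 1 exactly when [r <= 1 / 2]. Hence the two
    cases. *)
Lemma hinge_int_jump {R : realType} (s r : R) : 0 < s -> 0 < r < 1 ->
  hinge_int (s - r * s) (r * s) - hinge_int (s - r * s) s = s * unit_jump r.
Proof.
move=> s0 /andP[r0 r1]; have rs0 : 0 < r * s by exact: mulr_gt0.
have s_neq0 : s != 0 by rewrite gt_eqF.
have r_neq0 : r != 0 by rewrite gt_eqF.
rewrite /hinge_int /unit_jump.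
have -> : Num.min 1 ((s - r * s) / s) = 1 - r.
  rewrite min_r; first by field.
  by rewrite ler_pdivrMr//; nra.
case: ltP => r2.
  rewrite min_l; first by field.
  by rewrite ler_pdivlMr//; nra.
rewrite min_r; first by field; rewrite s_neq0 r_neq0.
by rewrite ler_pdivrMr//; nra.
Qed.

Lemma unit_jump_gt0 {R : realType} (r : R) : 0 <= r < 1 -> 0 < unit_jump r.
Proof.
move=> /andP[r0 r1]; rewrite /unit_jump; case: (ltP r (1 / 2)) => r2.
  by rewrite divr_gt0//; nra.
by rewrite divr_gt0// ?exprn_gt0//; lra.
Qed.

(** Eventually [u n] lies on the same side of 1/2 as [rho], so a single continuous formula
    applies. *)
Lemma cvg_unit_jump {R : realType} (u : nat -> R) (rho : R) :
  0 <= rho -> rho != 1 / 2 -> u @ \oo --> rho ->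
  (fun n => unit_jump (u n)) @ \oo --> unit_jump rho.
Proof.
move=> rho0; rewrite neq_lt => /orP[rho2|rho2] cu.
- rewrite [X in _ --> X](_ : _ = (1 - rho - rho * rho) / 2); last first.
    by rewrite /unit_jump rho2 expr2.
  apply: (@cvg_trans _ ((fun n => (1 - u n - u n * u n) / 2) @ \oo)).
    apply: near_eq_cvg; near=> n; rewrite /unit_jump ifT ?expr2//.
    by near: n; exact: (cvgr_lt rho).
  apply: cvgMl; apply: cvgB; last exact: cvgM.
  by apply: cvgB => //; exact: cvg_cst.
- rewrite [X in _ --> X](_ : _ =
    (1 - rho) * (1 - rho) * (1 - rho) * (2 * rho)^-1); last first.
    by rewrite /unit_jump ltNge ltW//= !exprS expr0 mulr1 !mulrA.
  apply: (@cvg_trans _ ((fun n =>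
    (1 - u n) * (1 - u n) * (1 - u n) * (2 * u n)^-1) @ \oo)).
    apply: near_eq_cvg; near=> n; rewrite /unit_jump ifF.
      by rewrite !exprS expr0 mulr1 !mulrA.
    apply/negbTE; rewrite -leNgt ltW//.
    by near: n; exact: (cvgr_gt rho).
  have c1 : (fun n => 1 - u n) @ \oo --> 1 - rho.
    by apply: cvgB => //; exact: cvg_cst.
  apply: cvgM; first by apply: cvgM => //; exact: cvgM.
  by apply: cvgV; [lra|exact: cvgMr].
Unshelve. all: by end_near. Qed.

Definition jump {R : realType} (t : nat -> R) (n : nat) : R :=
  hinge_int (gap t n) (t n.+1) - hinge_int (gap t n) (t n).

Lemma ratio_bounds {R : realType} (t : nat -> R) (n : nat) : is_partition t ->
  0 < t n.+1 / t n < 1.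
Proof.
case=> _ t01 t_decr _; have /andP[tn0 _] := t01 n; have /andP[tS0 _] := t01 n.+1.
by rewrite divr_gt0//= ltr_pdivrMr// mul1r.
Qed.

Lemma jumpE {R : realType} (t : nat -> R) (n : nat) : is_partition t ->
  jump t n = t n * unit_jump (t n.+1 / t n).
Proof.
move=> ht; have [_ t01 _ _] := ht; have /andP[tn0 _] := t01 n.
by rewrite -hinge_int_jump ?ratio_bounds// divfK ?gt_eqF.
Qed.

Lemma jump_gt0 {R : realType} (t : nat -> R) (n : nat) : is_partition t ->
  0 < jump t n.
Proof.
move=> ht; rewrite jumpE//; have [_ t01 _ _] := ht.
have /andP[tn0 _] := t01 n; apply: mulr_gt0 => //; apply: unit_jump_gt0.
by have /andP[/ltW -> ->] := ratio_bounds t n ht.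
Qed.

(** By [jumpE] the ratio is [t n.+1 / t n] times a quotient of consecutive values of [unit_jump],
    which tends to 1 since the limit of these values is nonzero. *)
Lemma cvg_jump_ratio {R : realType} (t : nat -> R) (rho : R) :
  is_partition t -> (fun n => t n.+1 / t n) @ \oo --> rho ->
  0 <= rho < 1 -> rho != 1 / 2 ->
  (fun n => jump t n.+1 / jump t n) @ \oo --> rho.
Proof.
move=> ht hrho rho01 rho2; have /andP[rho0 _] := rho01.
have g0 : unit_jump rho != 0 by rewrite gt_eqF ?unit_jump_gt0.
have cg := cvg_unit_jump _ _ rho0 rho2 hrho.
have -> : (fun n => jump t n.+1 / jump t n) = (fun n => t n.+1 / t n *
    (unit_jump (t n.+2 / t n.+1) / unit_jump (t n.+1 / t n))).
  by apply/funext => n; rewrite !jumpE// invfM mulrACA.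
rewrite -[X in _ --> X](mulr1 rho) -(divff g0).
apply: cvgM => //; apply: cvgM; last exact: cvgV.
by rewrite (cvg_shiftS (fun n => unit_jump (t n.+1 / t n))).
Qed.

(** * The values as a translate of the set of subsums of the jumps *)

Lemma endpoint_hinge_int {R : realType} (t : nat -> R) (eps : nat -> bool)
  (n : nat) :
  hinge_int (gap t n) (endpoint t eps n) =
  hinge_int (gap t n) (t n) + jump t n *+ ~~ eps n.
Proof.
rewrite /endpoint /jump; case: (eps n) => /=.
  by rewrite subn1 mulr0n addr0.
by rewrite subn0 mulr1n addrC subrK.
Qed.

Lemma cvg_series_jump {R : realType} (t : nat -> R) : is_partition t ->
  cvgn (series (jump t)).
Proof.
move=> ht; rewrite (_ : jump t =
  (fun k => hinge_int (gap t k) (endpoint t xpred0 k)) -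
  (fun k => hinge_int (gap t k) (endpoint t xpredT k))).
  by apply: is_cvg_seriesB; exact: cvg_series_hinge_int.
by apply/funext => k; rewrite !fctE /endpoint subn1 subn0.
Qed.

(** The translation is the value for [eps] constantly true, so the digits of the subsum are those of
    [~~ eps]; negation is a bijection of the choices. *)
Lemma MsetE {R : realType} (t : nat -> R) : is_partition t ->
  Mset t = [set limn (series (fun k => hinge_int (gap t k) (t k))) +
    subsum (jump t) eps | eps in [set: nat -> bool]].
Proof.
move=> ht.
have ME eps : Meps t eps = limn (series (fun k => hinge_int (gap t k) (t k))) +
    subsum (jump t) (fun k => ~~ eps k).
  have cu : cvgn (series (fun k => hinge_int (gap t k) (t k))).
    have := cvg_series_hinge_int t xpredT ht.
    by rewrite /endpoint; under eq_fun do rewrite subn1.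
  have cj := cvg_subsum (jump t) (fun k => ~~ eps k)
    (fun k => ltW (jump_gt0 t k ht)) (cvg_series_jump t ht).
  rewrite MepsE// -(lim_seriesD cu cj); congr (limn (series _)).
  by apply/funext => k; rewrite endpoint_hinge_int.
apply/seteqP; split=> [_ [eps _ <-]|_ [eps _ <-]].
  by rewrite ME; exists (fun k => ~~ eps k).
exists (fun k => ~~ eps k) => //; rewrite ME; congr (_ + subsum _ _).
by apply/funext => k; rewrite negbK.
Qed.

Theorem theorem1p3 (R : realType) (t : nat -> R) (rho : R)
  (ht : is_partition t)
  (hrho : (fun n => t n.+1 / t n) @ \oo --> rho) :
  (0 <= rho < 1 / 2 -> is_cantor_set (Mset t)) /\
  (1 / 2 < rho < 1 -> is_finite_union_of_closed_intervals (Mset t)).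
Proof.
have j0 k := jump_gt0 t k ht; have j0' k := ltW (j0 k).
have cj := cvg_series_jump t ht.
rewrite MsetE//; split => /andP[rho1 rho2].
(* The midpoint of [rho] and 1/2 serves as the ratio bound [q < 1 / 2]. *)
- have [|||N _ jN] := cvgr_lt rho (cvg_jump_ratio t rho ht hrho _ _)
    ((rho + 1 / 2) / 2); [lra|by rewrite lt_eqF|lra|].
  split.
  + by eexists; exists xpred0.
  + exact: compact_subsums.
  + apply: (interior_subsums _ _ ((rho + 1 / 2) / 2) N) => //; first by lra.
    by move=> k /jN /=; rewrite ltr_pdivrMr// => /ltW.
  + exact: subsums_not_isolated.
- have [|||N _ jN] := cvgr_gt rho (cvg_jump_ratio t rho ht hrho _ _)
    (1 / 2); [lra|by rewrite gt_eqF|lra|].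
  apply: (subsums_union _ _ N) => // k Nk.
  (* Jump ratios above 1/2 leave at least half of each tail after its first term, so that term is at
     most the rest. *)
  have : 1 / 2 * tail (jump t) k <= tail (jump t) k.+1.
    apply: tail_ratio_ge => // i ki.
    by have := jN i (leq_trans Nk ki); rewrite /= ltr_pdivlMr// => /ltW.
  by rewrite [tail _ k]tailS; lra.
Qed.
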